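(* For any $n\in\mathbb{Z}$, any $m_1,m_2\in\mathbb{Z}$ with $m_1+1<m_2$, and any $k\in\{0,1,\dots,\hat m_2\}$, where $\hat m_2:=m_2-m_1-1$, $$\underline{\nu}^n\left(\left\{\underline z: N^{\leftarrow p}_{m_2-1+\frac12}(\underline{z})-N^{\leftarrow p}_{m_1+\frac12}(\underline{z})=k\right\}\right)=q^{k(n+1+k-m_2)}(q;q)_\infty\begin{bmatrix}\hat m_2\\ k\end{bmatrix}_q\sum_{j=(m_2-1-n-k)^+}^\infty\frac{q^{j(n+1-m_2+k+j)+\hat m_2 j}}{(q;q)_j\,(q;q)_{n+1-m_2+k+j}}.$$
   Context: Fix $q\in(0,1)$. $(x)^+=\max\{x,0\}$. For $a\in\mathbb{R}$, $(a;q)_0=1$, $(a;q)_n=\prod_{i=0}^{n-1}(1-aq^i)$ for $n\ge1$, and $(a;q)_\infty=\prod_{i=0}^\infty(1-aq^i)$. The $q$-binomial coefficient is $\begin{bmatrix}n\\ m\end{bmatrix}_q=\frac{(q;q)_n}{(q;q)_m(q;q)_{n-m}}$ for $0\le m\le n$. For $c\in\mathbb{R}$, the blocking measure $\underline{\mu}^c$ of the asymmetric simple exclusion process (ASEP) is the product probability measure on $\{0,1\}^{\mathbb{Z}}$ under which the coordinates $z_i$ are independent with $\underline\mu^c(z_i=1)=\frac{q^{c-i}}{1+q^{c-i}}$. Let $N(\underline z)=\sum_{i=1}^\infty(1-z_i)-\sum_{i=-\infty}^0 z_i$, which is finite $\underline\mu^c$-a.s. For $n\in\mathbb{Z}$,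 the ergodic blocking measure is $\underline\nu^n(\cdot)=\underline\mu^c(\,\cdot\mid N=n)$; it does not depend on $c$. For $m\in\mathbb{Z}$, $N^{\leftarrow p}_{m+\frac12}(\underline z)=\sum_{i=-\infty}^m z_i$, so the difference in the claim is the number of particles on the sites $m_1+1,\dots,m_2-1$. *)

(* Defs.v *)
From HB Require Import structures.
From mathcomp Require Import all_boot all_order all_algebra.
From mathcomp Require Import all_classical all_reals all_analysis.
Set Implicit Arguments.
Unset Strict Implicit.
Unset Printing Implicit Defensive.
Import Order.TTheory GRing.Theory Num.Theory.
Import numFieldNormedType.Exports.
Local Open Scope classical_set_scope.
Local Open Scope ring_scope.

Section q_calculus.
Context {R : realType}.
Implicit Types (a q : R) (n m : nat).

Definition qpoch a q n : R := \prod_(i < n) (1 - a * q ^+ i).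

Definition qpoch_inf a q : R := limn (qpoch a q).

(* Only meaningful for m <= n, as n - m is truncated. *)
Definition qbinom q n m : R :=
  qpoch q q n / (qpoch q q m * qpoch q q (n - m)).

End q_calculus.

(* (x)^+ for an integer x, as a natural number *)
Definition posz_part (x : int) : nat := absz (Num.max x 0).

Definition config := int -> bool.

Definition coord (i : int) : config -> bool := fun z => z i.

Definition cylinders : set (set config) :=
  \bigcup_(i in [set: int]) preimage_set_system setT (coord i) measurable.

Notation configType := (g_sigma_algebraType cylinders).

Definition mutually_independent {d d'} {T : measurableType d}
    {T' : measurableType d'} {R : realType} {I : eqType}
    (P : probability T R) (X : I -> T -> T') : Prop :=
  forall (s : seq I) (A : I -> set T'), uniq s ->
    (forall i, i \in s -> measurable (A i)) ->
    P (\bigcap_(i in [set` s]) (X i @^-1` A i)) =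
    (\prod_(i <- s) P (X i @^-1` A i))%E.

(* Characterizes a unique mu: the product of Bernoulli laws over the sites. *)
Definition is_blocking_measure {R : realType} (q c : R)
    (mu : probability configType R) : Prop :=
  mutually_independent mu (coord : int -> configType -> bool) /\
  forall i : int,
    mu [set z | z i = true] =
    (q `^ (c - i%:~R) / (1 + q `^ (c - i%:~R)))%:E.

Section counting.
Context (R : realType).
Local Open Scope ereal_scope.

(* Equal to a finite value only when both series are finite: in \bar R,
   +oo - +oo = -oo. *)
Definition Ncount (z : config) : \bar R :=
  \sum_(1 <= i <oo) (1 - (z i%:Z)%:R)%R%:E -
  \sum_(0 <= i <oo) ((z (- i%:Z)%R)%:R)%R%:E.

(* Nleft m is the number of particles on the sites i <= m, i.e. the
   particle count with index m + 1/2. *)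
Definition Nleft (m : int) (z : config) : \bar R :=
  \sum_(0 <= i <oo) ((z (m - i%:Z)%R)%:R)%R%:E.

End counting.

Definition cond_prob {d} {T : measurableType d} {R : realType}
    (P : probability T R) (A B : set T) : \bar R :=
  (P (A `&` B) / P B)%E.

Definition ergodic_blocking {R : realType} (mu : probability configType R)
    (n : int) (A : set configType) : \bar R :=
  cond_prob mu A [set z | Ncount R z = (n%:~R)%:E].

(* Main.v *)
(* Take the site m = m2 - 1 as origin and let K, L, H be the numbers of particles
   on the sites m1 + 1, ..., m, of particles on the sites <= m1, and of holes on
   the sites > m.  Then N = H - L - K + m, and K, L, H are independent.  The
   count of successes in a window of M sites with odds x, x q, x q^2, ... takes
   the value j with probability x^j q^(j choose 2) [M choose j]_q divided by
   prod_(i < M) (1 + x q^i); letting M grow gives the laws of L and H.  Summing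
   over j = L with H = j + n + k - m yields mu(N = n, K = k) up to a constant
   depending only on n and m, and mu(N = n) is the instance where the block is
   empty, which the Durfee rectangle identity
   sum_j q^(j (j + a)) / ((q;q)_j (q;q)_(j + a)) = 1 / (q;q)_oo evaluates. *)
Require Import Defs.
From HB Require Import structures.
From mathcomp Require Import all_boot all_order all_algebra.
From mathcomp Require Import all_classical all_reals all_analysis.
From mathcomp Require Import measurable_realfun ring zify.
Import Order.TTheory GRing.Theory Num.Theory.
Import numFieldNormedType.Exports.
Local Open Scope classical_set_scope.
Local Open Scope ring_scope.

(** * Gaussian binomials and q-Pochhammer symbols *)

(* Defined by Pascal's rule, so that it vanishes for m > n, unlike [qbinom]. *)
Fixpoint gbin {R : realType} (q : R) (n m : nat) : R :=
  match m, n with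
  | 0%N, _ => 1
  | _.+1, 0%N => 0
  | m'.+1, n'.+1 => gbin q n' m' + q ^+ m * gbin q n' m
  end.

Lemma gbin_gt {R : realType} (q : R) n m : (n < m)%N -> gbin q n m = 0.
Proof.
elim: n m => [|n IH] [|m] //= nm.
by rewrite !IH ?mulr0 ?addr0 //; lia.
Qed.

Lemma gbin0 {R : realType} (q : R) n : gbin q n 0 = 1.
Proof. by case: n. Qed.

Lemma gbinS {R : realType} (q : R) n m :
  gbin q n.+1 m.+1 = gbin q n m + q ^+ m.+1 * gbin q n m.+1.
Proof. by []. Qed.

Lemma qpochS {R : realType} (a q : R) n :
  qpoch a q n.+1 = qpoch a q n * (1 - a * q ^+ n).
Proof. by rewrite /qpoch big_ord_recr. Qed.

Lemma qpoch0 {R : realType} (a q : R) : qpoch a q 0 = 1.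
Proof. by rewrite /qpoch big_ord0. Qed.

(** In the inductive step the two terms of Pascal's rule contribute the factors 1 - q^(m+1) and
    q^(m+1) - q^(n+1), which add up to 1 - q^(n+1). *)
Lemma gbin_qpoch {R : realType} (q : R) n m : (m <= n)%N ->
  gbin q n m * (qpoch q q m * qpoch q q (n - m)) = qpoch q q n.
Proof.
elim: n m => [|n IH] [|m] // mn; rewrite ?gbin0 ?qpoch0 ?subn0 ?mul1r //.
rewrite gbinS subSS mulrDl.
have -> : gbin q n m * (qpoch q q m.+1 * qpoch q q (n - m)) =
          (1 - q ^+ m.+1) * qpoch q q n.
  by rewrite -(IH m) // qpochS exprS; ring.
have [mn'|mn'] := ltnP m n; last first.
  have -> : m = n by lia.
  by rewrite gbin_gt // qpochS exprS; ring.
have -> : (n - m = (n - m.+1).+1)%N by lia.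
rewrite [qpoch q q (n - m.+1).+1]qpochS.
have -> : q ^+ m.+1 * gbin q n m.+1 * (qpoch q q m.+1 *
   (qpoch q q (n - m.+1) * (1 - q * q ^+ (n - m.+1)))) =
   (q ^+ m.+1 - q * q ^+ (m.+1 + (n - m.+1))) * qpoch q q n.
  by rewrite -(IH m.+1) // exprD; ring.
rewrite subnKC // [in RHS]qpochS; ring.
Qed.

Section unit_interval.
Context {R : realType} (q : R) (q_gt0 : 0 < q) (q_lt1 : q < 1).
Local Notation P := (qpoch q q).

Lemma qpoch_gt0 n : 0 < P n.
Proof.
apply: prodr_gt0 => i _; rewrite -exprS subr_gt0.
by apply: exprn_ilt1 => //; apply: ltW.
Qed.

Lemma qpoch_neq0 n : P n != 0.
Proof. by rewrite gt_eqF ?qpoch_gt0. Qed.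

Lemma gbinE n m : (m <= n)%N -> gbin q n m = P n / (P m * P (n - m)).
Proof.
by move=> mn; apply: (canRL (mulfK _)); rewrite ?mulf_neq0 ?qpoch_neq0 ?gbin_qpoch.
Qed.

Lemma gbin_qbinom n m : (m <= n)%N -> gbin q n m = qbinom q n m.
Proof. exact: gbinE. Qed.

Lemma gbin_ge0 n m : 0 <= gbin q n m.
Proof.
elim: n m => [|n IH] [|m] //=.
by rewrite addr_ge0 // mulr_ge0 // exprn_ge0 // ltW.
Qed.

(** The mirrored Pascal rule: after clearing denominators it reads (1 - q^(n-m)) + q^(n-m) (1 -
    q^(m+1)) = 1 - q^(n+1). *)
Lemma gbinSr n m : (m <= n)%N ->
  gbin q n.+1 m.+1 = gbin q n m.+1 + q ^+ (n - m) * gbin q n m.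
Proof.
rewrite leq_eqVlt => /orP[/eqP ->|mn].
  by rewrite gbinS subnn [gbin q n n.+1]gbin_gt // mulr0 addr0 add0r expr0 mul1r.
apply: (@mulIf _ (P m.+1 * P (n - m))); first by rewrite mulf_neq0 ?qpoch_neq0.
rewrite -[in LHS]subSS gbin_qpoch 1?ltnW // mulrDl.
have -> : q ^+ (n - m) * gbin q n m * (P m.+1 * P (n - m)) =
   q ^+ (n - m) * (1 - q ^+ m.+1) * P n.
  by rewrite -(gbin_qpoch q n m) 1?ltnW // qpochS exprS; ring.
have {1}-> : (n - m = (n - m.+1).+1)%N by lia.
rewrite [P (n - m.+1).+1]qpochS.
have -> : gbin q n m.+1 * (P m.+1 * (P (n - m.+1) * (1 - q * q ^+ (n - m.+1)))) =
   (1 - q ^+ (n - m)) * P n.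
  by rewrite -(gbin_qpoch q n m.+1) // (_ : n - m = (n - m.+1).+1)%N ?exprS; [ring|lia].
rewrite qpochS -exprS.
have -> : q ^+ n.+1 = q ^+ (n - m) * q ^+ m.+1 by rewrite -exprD; congr (_ ^+ _); lia.
ring.
Qed.

(** Finite form of the Durfee rectangle identity, by induction on [M] for all [n] at once. The
    mirrored Pascal rule splits the sum for [M.+1] into the sum for (M, n) plus q^(M+n+1) times the
    sum for (M, n+1), and 1/P(M+n) + q^(M+n+1)/P(M+n+1) = 1/P(M+n+1). *)
Lemma finite_durfee M n :
  \sum_(j < M.+1) q ^+ (j * (j + n)) * gbin q M j / P (j + n) = (P (M + n))^-1.
Proof.
elim: M n => [|M IH] n.
  by rewrite big_ord_recl big_ord0 /= mul0n expr0 !mul1r addr0.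
pose G N j := q ^+ (j * (j + n)) * gbin q N j / P (j + n).
have GS (i : 'I_M.+1) : G M.+1 i.+1 = G M i.+1 + q ^+ (M + n).+1 *
    (q ^+ (i * (i + n.+1)) * gbin q M i / P (i + n.+1)).
  have iM : (i <= M)%N by rewrite -ltnS.
  rewrite /G gbinSr // addSnnS.
  have -> : q ^+ (i.+1 * (i + n.+1)) * (gbin q M i.+1 + q ^+ (M - i) * gbin q M i) =
     q ^+ (i.+1 * (i + n.+1)) * gbin q M i.+1 +
     q ^+ ((M + n).+1 + i * (i + n.+1)) * gbin q M i.
    have -> : ((M + n).+1 + i * (i + n.+1) = i.+1 * (i + n.+1) + (M - i))%N by nia.
    by rewrite exprD; ring.
  by rewrite exprD; ring.
rewrite -[LHS]/(\sum_(j < M.+2) G M.+1 j) big_ord_recl /=.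
under eq_bigr => i _ do rewrite /bump /= add1n GS.
rewrite big_split /= -mulr_sumr IH addrA.
have -> : G M.+1 0%N + \sum_(i < M.+1) G M i.+1 = (P (M + n))^-1.
  rewrite -IH -[RHS]/(\sum_(j < M.+1) G M j).
  (* The added term of index [M.+1] is 0, because [gbin] vanishes above the diagonal. *)
  have -> : \sum_(j < M.+1) G M j = \sum_(j < M.+2) G M j.
    by rewrite [RHS]big_ord_recr /= {3}/G gbin_gt // mulr0 mul0r addr0.
  by rewrite [RHS]big_ord_recl /= /G !gbin0; congr (_ + _); apply: eq_bigr => i _.
rewrite addSn -addnS addnS qpochS -exprS.
have : 1 - q ^+ (M + n).+1 != 0.
  by have := qpoch_neq0 (M + n).+1; rewrite qpochS mulf_eq0 negb_or exprS => /andP[].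
have := qpoch_neq0 (M + n).
by move=> h1 h2; field; rewrite h1 h2.
Qed.

(** Uses 1 + y <= exp y factor by factor, then bounds the geometric sum by 1/(1 - q). *)
Lemma prod_geometric_le t n : 0 <= t ->
  \prod_(i < n) (1 + t * q ^+ i) <= expR (t / (1 - q)).
Proof.
move=> t0; have q1 : 0 < 1 - q by rewrite subr_gt0.
apply: (@le_trans _ _ (expR (\sum_(i < n) t * q ^+ i))).
  rewrite expR_sum; apply: ler_prod => i _.
  by rewrite expR_ge1Dx addr_ge0 // mulr_ge0 // exprn_ge0 // ltW.
rewrite ler_expR -mulr_sumr ler_wpM2l // -[leRHS]mul1r ler_pdivlMr //.
have -> : (\sum_(i < n) q ^+ i) * (1 - q) = 1 - q ^+ n.
  by rewrite mulrC -[LHS]opprK -mulNr opprB -subrX1 opprB.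
by rewrite gerBl exprn_ge0 // ltW.
Qed.

Lemma nonincreasing_qpoch : nonincreasing_seq P.
Proof.
apply/nonincreasing_seqP => n; rewrite qpochS -[leRHS]mulr1.
by rewrite ler_wpM2l ?ltW ?qpoch_gt0 // ltrBlDr ltrDl -exprS exprn_gt0.
Qed.

(** A bound uniform in [n], which makes the limit positive. Each factor satisfies (1 - q^(i+1)) (1 +
    q^(i+1)/(1 - q)) >= 1, and the product of the second factors is bounded by
    [prod_geometric_le]. *)
Lemma qpoch_ge n : expR (- (q / (1 - q) / (1 - q))) <= P n.
Proof.
have q1 : 0 < 1 - q by rewrite subr_gt0.
rewrite expRN; set E := expR _.
have E0 : 0 < E by apply: expR_gt0.
rewrite -[leLHS]mul1r ler_pdivrMr //.
have t0 : 0 <= q / (1 - q) by rewrite divr_ge0 // ltW.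
apply: (@le_trans _ _ (P n * \prod_(i < n) (1 + q / (1 - q) * q ^+ i))); last first.
  by rewrite ler_wpM2l ?prod_geometric_le // ltW // qpoch_gt0.
rewrite -big_split /=; apply: (@le_trans _ _ (\prod_(i < n) 1)); first by rewrite big1_eq.
apply: ler_prod => i _; rewrite ler01 /=.
have qi0 : 0 <= q ^+ i by rewrite exprn_ge0 // ltW.
have qi1 : q ^+ i <= 1 by rewrite exprn_ile1 // ltW.
have -> : (1 - q * q ^+ i) * (1 + q / (1 - q) * q ^+ i) =
  1 + q ^+ 2 * q ^+ i * (1 - q ^+ i) / (1 - q).
  by field; rewrite gt_eqF.
by rewrite lerDl divr_ge0 ?mulr_ge0 ?subr_ge0 // ltW.
Qed.

Lemma cvg_qpoch : P @ \oo --> qpoch_inf q q.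
Proof.
apply: nonincreasing_is_cvgn; first exact: nonincreasing_qpoch.
by exists 0 => _ [n _ <-]; rewrite ltW // qpoch_gt0.
Qed.

Lemma qpoch_inf_gt0 : 0 < qpoch_inf q q.
Proof.
apply: (lt_le_trans (expR_gt0 (- (q / (1 - q) / (1 - q))))).
apply: limr_ge; first by apply/cvg_ex; exists (qpoch_inf q q); exact: cvg_qpoch.
by apply: nearW => n; exact: qpoch_ge.
Qed.

Lemma qpoch_inf_neq0 : qpoch_inf q q != 0.
Proof. by rewrite gt_eqF ?qpoch_inf_gt0. Qed.

Lemma cvg_qpochV : (P M)^-1 @[M --> \oo] --> (qpoch_inf q q)^-1.
Proof. by apply: cvgV; [exact: qpoch_inf_neq0|exact: cvg_qpoch]. Qed.

(** Shifting [M] by [j] avoids truncated subtraction; then P(M+j)/P(M) tends to 1, as both parts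
    have the same nonzero limit. *)
Lemma cvg_gbin j : gbin q M j @[M --> \oo] --> (P j)^-1.
Proof.
have cPj : P (M + j) @[M --> \oo] --> qpoch_inf q q.
  by have := cvg_qpoch; rewrite -(cvg_shiftn j).
have c2 : P (M + j) / P M * (P j)^-1 @[M --> \oo] --> qpoch_inf q q / qpoch_inf q q * (P j)^-1.
  by apply: cvgMr_tmp; apply: cvgM => //; exact: cvg_qpochV.
move: c2; rewrite divff ?mul1r ?qpoch_inf_neq0 // => c2.
suff : gbin q (M + j) j @[M --> \oo] --> (P j)^-1 by move=> h; rewrite -(cvg_shiftn j).
suff -> : (fun M => gbin q (M + j) j) = (fun M => P (M + j) / P M * (P j)^-1) by [].
by apply/funext => M /=; rewrite gbinE ?leq_addl // addnK invfM; ring.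
Qed.

(** A squeeze from the finite identity. As [gbin q M j <= (P j)^-1], the partial sum up to [M] is at
    least 1/P(M+n). Conversely, a fixed partial sum is the limit over K of truncations of the finite
    identity for K, each at most 1/P(K+n). *)
Lemma durfee n :
  \sum_(0 <= j < J) q ^+ (j * (j + n)) / (P j * P (j + n)) @[J --> \oo]
    --> (qpoch_inf q q)^-1.
Proof.
have cvgPn k : (P (M + k))^-1 @[M --> \oo] --> (qpoch_inf q q)^-1.
  by have := cvg_qpochV; rewrite -(cvg_shiftn k).
have t0 i k : 0 <= q ^+ i / P k.
  by rewrite divr_ge0 ?exprn_ge0 // ltW // qpoch_gt0.
have termlim J : (fun M => \sum_(0 <= j < J) q ^+ (j * (j + n)) * gbin q M j / P (j + n))
     @ \oo --> \sum_(0 <= j < J) q ^+ (j * (j + n)) / (P j * P (j + n)).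
  elim: J => [|J IH].
    by rewrite big_nil; under eq_fun do rewrite big_nil; exact: cvg_cst.
  rewrite big_nat_recr //=; under eq_fun do rewrite big_nat_recr //=.
  apply: cvgD => //.
  have -> : q ^+ (J * (J + n)) / (P J * P (J + n)) = q ^+ (J * (J + n)) * (P J)^-1 / P (J + n).
    by rewrite invfM mulrA.
  by apply: cvgMr_tmp; apply: cvgMl_tmp; exact: cvg_gbin.
have gle M j : gbin q M j <= (P j)^-1.
  have [jM|Mj] := leqP j M; last by rewrite gbin_gt // invr_ge0 ltW // qpoch_gt0.
  rewrite gbinE // invfM mulrCA ler_piMr ?invr_ge0 ?(ltW (qpoch_gt0 _)) //.
  by rewrite ler_pdivrMr ?qpoch_gt0 // mul1r nonincreasing_qpoch // leq_subr.
rewrite -(cvg_shiftn 1).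
apply: (@squeeze_cvgr _ _ _ _ (fun M => (P (M + n))^-1) (fun=> (qpoch_inf q q)^-1));
  [|exact: cvgPn|exact: cvg_cst].
apply: nearW => M /=; apply/andP; split.
  rewrite -finite_durfee big_mkord addn1; apply: ler_sum => j _.
  by rewrite invfM -mulrA [_ * (_ * (P (j + n))^-1)]mulrA !mulrA ler_wpM2r
       ?invr_ge0 ?(ltW (qpoch_gt0 _)) // ler_wpM2l ?exprn_ge0 // ltW.
apply: (ler_cvg_to (termlim (M + 1)%N) (cvgPn n)).
near=> K; rewrite -finite_durfee !big_mkord.
rewrite (big_ord_widen_cond K.+1 xpredT
  (fun j => q ^+ (j * (j + n)) * gbin q K j / P (j + n))) /=; last first.
  by near: K; exists M.+1 => // k /=; lia.
rewrite big_mkcond /=; apply: ler_sum => j _.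
case: ifP => // _.
by rewrite mulr_ge0 ?mulr_ge0 ?exprn_ge0 ?gbin_ge0 ?invr_ge0 // ltW // qpoch_gt0.
Unshelve. all: by end_near. Qed.

(** Only positivity of the limit is recorded: it enters a normalising constant that cancels on
    conditioning. *)
Lemma cvg_prod_geometric t : 0 <= t -> exists2 l : R, 0 < l &
  \prod_(i < n) (1 + t * q ^+ i) @[n --> \oo] --> l.
Proof.
move=> t0; pose f n := \prod_(i < n) (1 + t * q ^+ i).
have tq n : 0 <= t * q ^+ n by rewrite mulr_ge0 // exprn_ge0 // ltW.
have f1 n : 1 <= f n.
  apply: (@le_trans _ _ (\prod_(i < n) 1)); first by rewrite big1_eq.
  by apply: ler_prod => i _; rewrite ler01 lerDl tq.
have cf : cvgn f.
  apply: nondecreasing_is_cvgn.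
    apply/nondecreasing_seqP => n; rewrite /f big_ord_recr /= ler_peMr ?lerDl //.
    exact: le_trans (f1 n).
  by exists (expR (t / (1 - q))) => _ [n _ <-]; exact: prod_geometric_le.
exists (limn f) => //; apply: (lt_le_trans ltr01); apply: limr_ge => //.
exact: nearW.
Qed.
End unit_interval.

(** * Counts of independent coordinates in finite windows *)

(** The Poisson binomial distribution with success probabilities [s], by conditioning on the first
    trial. *)
Fixpoint bernoulli_sum_law {R : realType} (s : seq R) (j : nat) : R :=
  if s is a :: s' then
    (if j is j'.+1 then a * bernoulli_sum_law s' j' else 0) +
    (1 - a) * bernoulli_sum_law s' j
  else (j == 0%N)%:R.

(** The q-binomial theorem read coefficientwise. The first site [a] is general because the recursion
    moves it to [a.+1]; success and failure at that site yield the two terms of Pascal's rule. *)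
Lemma bernoulli_sum_law_geometric {R : realType} (q x : R) M a j :
  0 < q -> 0 < x ->
  bernoulli_sum_law [seq x * q ^+ i / (1 + x * q ^+ i) | i <- iota a M] j =
  (x * q ^+ a) ^+ j * q ^+ 'C(j, 2) * gbin q M j *
  \prod_(i <- iota a M) (1 + x * q ^+ i)^-1.
Proof.
move=> q0 x0; have nz i : 1 + x * q ^+ i != 0.
  by rewrite gt_eqF // addr_gt0 // mulr_gt0 // exprn_gt0.
elim: M a j => [|M IH] a j /=.
  by rewrite big_nil mulr1; case: j => [|j] /=; rewrite ?mulr0 ?expr0 ?mulr1.
rewrite big_cons !IH exprS.
case: j => [|j].
  rewrite !gbin0 bin0n ?expr0 ?mul1r ?mulr1 ?add0r.
  by field; rewrite nz.
have -> : 'C(j.+1, 2) = ('C(j, 2) + j)%N by rewrite binS bin1 addnC.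
rewrite IH /= [x * (q * _)]mulrCA !exprMn !exprD !exprS ?exprMn.
by field; rewrite nz.
Qed.

Definition cylinder (s : seq int) (w : config) : set configType :=
  [set z | forall i, i \in s -> z i = w i].

Section independence.
Context {R : realType} {mu : probability configType R} {p : int -> bool -> R}.
Hypothesis mu_indep : mutually_independent mu (Defs.coord : int -> configType -> bool).
Hypothesis mu_coord : forall i b, mu [set z | z i = b] = (p i b)%:E.

Lemma measurable_coord i b : measurable ([set z | z i = b] : set configType).
Proof.
apply: sub_sigma_algebra; exists i => //; exists [set b] => //.
by rewrite setTI.
Qed.

Lemma marginalN i b : p i (~~ b) = 1 - p i b.
Proof.
have := probability_setC mu (measurable_coord i b).
have -> : ~` [set z | z i = b] = [set z | z i = ~~ b] :> set configType.
  by apply/seteqP; split => z /=; case: (z i); case: b.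
by rewrite !mu_coord => -[].
Qed.

Lemma cylinder_cons i s w :
  cylinder (i :: s) w = [set z | z i = w i] `&` cylinder s w.
Proof.
apply/seteqP; split => z /=.
  by move=> h; split=> [|j js]; apply: h; rewrite inE ?eqxx // js orbT.
by move=> [h1 h2] j; rewrite inE => /orP[/eqP->|/h2].
Qed.

Lemma measurable_cylinder s w : measurable (cylinder s w).
Proof.
elim: s => [|i s IH].
  have -> : cylinder [::] w = setT by apply/seteqP; split.
  exact: measurableT.
by rewrite cylinder_cons; apply: measurableI => //; exact: measurable_coord.
Qed.

Lemma mu_cylinder s w : uniq s -> mu (cylinder s w) = (\prod_(i <- s) p i (w i))%:E.
Proof.
move=> us; have := mu_indep s (fun i => [set w i]) us (fun i _ => I).
have -> : \bigcap_(i in [set` s]) ((Defs.coord : int -> configType -> bool) i @^-1` [set w i])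
   = cylinder s w by [].
by move=> ->; rewrite -prodEFin; apply: eq_bigr => i _; rewrite -mu_coord.
Qed.

(* [E] has probability [v] and is independent of the coordinates outside [s]. *)
Definition indep_event (s : seq int) (E : set configType) (v : R) : Prop :=
  measurable E /\ forall t w, uniq (s ++ t) ->
    mu (E `&` cylinder t w) = (v * \prod_(i <- t) p i (w i))%:E.

Lemma indep_eventT : indep_event [::] setT 1.
Proof.
by split; [exact: measurableT|move=> t w ut; rewrite setTI mul1r mu_cylinder].
Qed.

Lemma indep_event_prob s E v : uniq s -> indep_event s E v -> mu E = v%:E.
Proof.
move=> us [_ /(_ [::] (fun=> true))]; rewrite cats0 big_nil mulr1 => <- //.
by congr (mu _); apply/seteqP; split => z // [].
Qed.

Lemma indep_event_coord i b s E v : indep_event s E v ->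
  indep_event (i :: s) ([set z | z i = b] `&` E) (p i b * v).
Proof.
move=> [mE h]; split; first by apply: measurableI => //; exact: measurable_coord.
move=> t w ut.
(* Overriding [w] at [i] turns the extra condition into part of a cylinder over [i :: t], to which
   independence of [E] applies. *)
pose w' j := if j == i then b else w j.
have it : i \notin t by case/andP: ut; rewrite mem_cat negb_or => /andP[].
have wt j : j \in t -> w' j = w j.
  by move=> jt; rewrite /w'; case: eqP => // ji; rewrite -ji jt in it.
have -> : [set z | z i = b] `&` E `&` cylinder t w = E `&` cylinder (i :: t) w'.
  rewrite cylinder_cons {1}/w' eqxx.
  have -> : cylinder t w' = cylinder t w.
    by apply/seteqP; split => z hz j jt; rewrite hz ?wt.
  by rewrite setIA [E `&` _]setIC.
rewrite h; last by rewrite -cat1s uniq_catCA.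
congr (_%:E); rewrite big_cons /w' eqxx -/w' mulrCA mulrA; congr (_ * _).
by apply: eq_big_seq => j /wt; rewrite /w' => ->.
Qed.

Lemma indep_event_setU s E E' v v' : E `&` E' = set0 ->
  indep_event s E v -> indep_event s E' v' -> indep_event s (E `|` E') (v + v').
Proof.
move=> d [mE h] [mE' h']; split; first exact: measurableU.
move=> t w ut; rewrite setIUl measureU; last 3 first.
- by apply: measurableI => //; exact: measurable_cylinder.
- by apply: measurableI => //; exact: measurable_cylinder.
- by rewrite setIACA d set0I.
by rewrite mulrDl EFinD -h // -h'.
Qed.

(** Splitting on the first site reproduces the recursion of [bernoulli_sum_law]. The flag [b]
    selects particles or holes, and repeated use over disjoint windows gives products of laws. *)
Lemma indep_event_count b s' s E v j : indep_event s E v ->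
  indep_event (s' ++ s) ([set z | count (fun i => z i == b) s' = j] `&` E)
    (bernoulli_sum_law [seq p i b | i <- s'] j * v).
Proof.
move=> hE; elim: s' j => [|i s' IH] j.
  case: j => [|j] /=.
    by rewrite mul1r; have -> : [set z : configType | 0%N = 0%N] `&` E = E
      by apply/seteqP; split => z // [].
  have -> : [set z : configType | 0%N = j.+1] `&` E = set0.
    by apply/seteqP; split => z // [].
  rewrite mul0r; split; first exact: measurable0.
  by move=> t w _; rewrite set0I measure0 mul0r.
pose C k := [set z : configType | count (fun i => z i == b) s' = k] `&` E.
have -> : [set z : configType | count (fun i => z i == b) (i :: s') = j] `&` E =
  (if j is j'.+1 then [set z : configType | z i = b] `&` C j' else set0) `|`
  ([set z : configType | z i = ~~ b] `&` C j).
  apply/seteqP; split => z /=.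
    move=> [zj zE]; have [zb|zb] := eqVneq (z i) b.
      by left; move: zj; rewrite zb eqxx add1n => <-.
    right; rewrite (negbTE zb) add0n in zj; split=> //.
    by move: zb; case: (z i); case: (b).
  case=> [|[zb [zj zE]]]; last by rewrite zb zj; split => //; case: (b).
  by case: j => [//|j] [zb [zj zE]]; rewrite zb eqxx zj.
rewrite mulrDl; apply: indep_event_setU.
- apply/seteqP; split => z //=; case=> h [h' _]; case: j h => [//|j] [h _].
  by move: h'; rewrite h; case: (b).
- case: j => [|j]; last by rewrite -mulrA; apply: indep_event_coord; exact: IH.
  rewrite mul0r; split; first exact: measurable0.
  by move=> t w _; rewrite set0I measure0 mul0r.
- by rewrite -marginalN -mulrA; apply: indep_event_coord; exact: IH.
Qed.

End independence.

(** * Counts over half-lines *)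

(** The indicators of [E_] converge pointwise to that of [E], so dominated convergence with bound 1
    applies. *)
Lemma cvg_probability {d} {T : measurableType d} {R : realType}
    (P : probability T R) (E_ : (set T)^nat) (E : set T) :
  (forall n, measurable (E_ n)) ->
  (forall x, E x -> \forall n \near \oo, E_ n x) ->
  (forall x, ~ E x -> \forall n \near \oo, ~ E_ n x) ->
  measurable E /\ P (E_ n) @[n --> \oo] --> P E.
Proof.
move=> mE_ hE hnE.
have mE : measurable E.
  (* [E] is the lower limit of the sequence, hence measurable. *)
  have -> : E = \bigcup_n \bigcap_(m in [set m | (n <= m)%N]) E_ m.
    apply/seteqP; split => x.
      by move=> /hE [N _ hN]; exists N => // m /= Nm; exact: hN.
    move=> [N _ hN]; apply: contrapT => /hnE [N' _ hN'].
    by apply: (hN' (maxn N N')) => /=; [exact: leq_maxr|apply: hN; exact: leq_maxl].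
  by apply: bigcup_measurable => n _; apply: bigcap_measurableType => m _.
split=> //.
have ind (A : set T) : measurable A -> P A = (\int[P]_x (\1_A x : R)%:E)%E.
  by move=> mA; rewrite integral_indic ?setIT.
rewrite ind //; under eq_fun do rewrite ind //.
apply: (@dominated_cvg _ _ _ P setT measurableT _ _ (fun=> 1%E)) => //.
- by move=> n; apply/measurable_EFinP; exact: measurable_indic.
- move=> x _; apply: cvg_near_cst.
  have [Ex|nEx] := pselect (E x).
    by near do rewrite !indicE !mem_set //; exact: hE.
  by near do rewrite !indicE !memNset //; exact: hnE.
- exact: finite_measure_integrable_cst.
- by move=> n x _; rewrite indicE; case: (_ \in _); rewrite ?normr1 ?normr0 ?abse1 ?abse0.
Unshelve. all: by end_near. Qed.

(** Total counts are expressed through finite windows, the form in which [cvg_probability] can pass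
    to the limit. *)
Definition eventual_count (b : nat -> bool) (j : nat) : Prop :=
  exists N, forall M, (N <= M)%N -> count b (iota 0 M) = j.

Lemma count_iota_le (b : nat -> bool) M N : (M <= N)%N ->
  (count b (iota 0 M) <= count b (iota 0 N))%N.
Proof. by move=> MN; rewrite -(subnKC MN) iotaD count_cat leq_addr. Qed.

Lemma eventual_count_inj (b : nat -> bool) j j' :
  eventual_count b j -> eventual_count b j' -> j = j'.
Proof.
move=> [N hN] [N' hN'].
by rewrite -(hN (maxn N N')) ?leq_maxl // (hN' (maxn N N')) // leq_maxr.
Qed.

(** Window counts are nondecreasing, so a value taken in arbitrarily large windows is taken in all
    later ones. *)
Lemma eventual_countPn (b : nat -> bool) j : ~ eventual_count b j ->
  exists N, forall M, (N <= M)%N -> count b (iota 0 M) <> j.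
Proof.
move=> nb; apply: contrapT => h; apply: nb.
have h' N : exists2 M, (N <= M)%N & count b (iota 0 M) = j.
  apply: contrapT => h2; apply: h; exists N => M NM bM; apply: h2; by exists M.
have [N _ hN] := h' 0%N; exists N => M NM.
have [M' MM' hM'] := h' M.
apply/eqP; rewrite eqn_leq -{1}hM' -hN.
by rewrite !count_iota_le.
Qed.

(** Induction on the bound: once the count has reached [K] it must eventually avoid [K], hence
    exceed it. *)
Lemma eventual_count_unbounded (b : nat -> bool) :
  (forall j, ~ eventual_count b j) -> forall K, exists M, (K <= count b (iota 0 M))%N.
Proof.
move=> nb; elim=> [|K [M KM]]; first by exists 0%N.
have [N hN] := eventual_countPn _ _ (nb K).
exists (maxn N M); rewrite ltn_neqAle eq_sym; apply/andP; split.
  by apply/eqP; apply: hN; exact: leq_maxl.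
by apply: leq_trans KM _; apply: count_iota_le; exact: leq_maxr.
Qed.

Lemma eventual_count_ge (b : nat -> bool) j : eventual_count b j -> (b 0%N <= j)%N.
Proof.
move=> [N hN]; rewrite -(hN N.+1) //=; exact: leq_addr.
Qed.

Section series.
Context {R : realType}.

Lemma sum_bool_count (b : nat -> bool) M :
  (\sum_(0 <= i < M) ((b i)%:R : R)%:E)%E = ((count b (iota 0 M))%:R)%:E.
Proof.
rewrite sumEFin -sum1_count natr_sum /index_iota subn0 [in RHS]big_mkcond.
by congr (_%:E); apply: eq_bigr => i _; case: (b i).
Qed.

Lemma eventual_count_series (b : nat -> bool) j : eventual_count b j ->
  (\sum_(0 <= i <oo) ((b i)%:R : R)%:E)%E = j%:R%:E.
Proof.
move=> [N hN]; apply: lim_near_cst => //.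
by exists N => // M /= NM; rewrite sum_bool_count hN.
Qed.

Lemma series_infinite_count (b : nat -> bool) : (forall j, ~ eventual_count b j) ->
  (\sum_(0 <= i <oo) ((b i)%:R : R)%:E)%E = +oo%E.
Proof.
move=> /eventual_count_unbounded h; apply/eqyP => r r0.
have [M hM] := h (Num.truncn r).+1.
apply: (@le_trans _ _ (\sum_(0 <= i < M) ((b i)%:R : R)%:E)%E); last first.
  by apply: nneseries_lim_ge => i _ _; rewrite lee_fin ler0n.
rewrite sum_bool_count lee_fin; apply: le_trans (ltW (truncnS_gt r)) _.
by rewrite ler_nat.
Qed.

Lemma series_countP (b : nat -> bool) :
  (exists2 j, eventual_count b j & (\sum_(0 <= i <oo) ((b i)%:R : R)%:E)%E = j%:R%:E) \/
  (\sum_(0 <= i <oo) ((b i)%:R : R)%:E)%E = +oo%E.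
Proof.
have [[j hj]|h] := pselect (exists j, eventual_count b j).
  by left; exists j => //; exact: eventual_count_series.
by right; apply: series_infinite_count => j hj; apply: h; exists j.
Qed.
End series.

(** * Joint law of the block count and the two half-line counts *)

Definition left_occ (m : int) (z : config) (i : nat) : bool := z (m - i%:Z).
Definition right_vac (m : int) (z : config) (i : nat) : bool := ~~ z (m + 1 + i%:Z).

Section joint_law.
Context {R : realType} {mu : probability configType R} {p : int -> bool -> R}.
Hypothesis mu_indep : mutually_independent mu (Defs.coord : int -> configType -> bool).
Hypothesis mu_coord : forall i b, mu [set z | z i = b] = (p i b)%:E.
Context {q x : R} (q_gt0 : 0 < q) (q_lt1 : q < 1) (x_gt0 : 0 < x) (m : int).
Hypothesis p_left : forall l : nat,
  p (m - l%:Z) true = x * q ^+ l / (1 + x * q ^+ l).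
Hypothesis p_right : forall l : nat,
  p (m + 1 + l%:Z) false = q / x * q ^+ l / (1 + q / x * q ^+ l).

Definition triple_event (d k j h : nat) : set configType :=
  [set z | [/\ count (left_occ m z) (iota 0 d) = k,
     eventual_count (left_occ (m - d%:Z) z) j & eventual_count (right_vac m z) h]].

Lemma window_uniq d M :
  uniq ([seq m - l%:Z | l <- iota 0 d] ++ [seq m - l%:Z | l <- iota d M] ++
        [seq m + 1 + l%:Z | l <- iota 0 M]).
Proof.
rewrite catA -map_cat -(iotaD 0 d M) cat_uniq !map_inj_uniq ?iota_uniq /=;
  try by move=> a b; lia.
rewrite andbT; apply/hasPn => _ /mapP[l _ ->]; apply/mapP => -[l' _]; lia.
Qed.

(** Here [x] is the odds of a particle at [m], and [q / x] the odds of a hole at [m + 1]. The three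
    factors belong to the block, the next [M] sites to its left, and the [M] sites to the right of
    [m]; the denominators of the first two merge into one product over [d + M] sites. *)
Definition window_law (d M k j h : nat) : R :=
  (x ^+ k * q ^+ 'C(k, 2) * gbin q d k) *
  ((x * q ^+ d) ^+ j * q ^+ 'C(j, 2) * gbin q M j) *
  ((q / x) ^+ h * q ^+ 'C(h, 2) * gbin q M h) /
  (\prod_(i < d + M) (1 + x * q ^+ i) * \prod_(i < M) (1 + q / x * q ^+ i)).

Lemma window_event d M k j h :
  let E := [set z : configType | [/\ count (left_occ m z) (iota 0 d) = k,
     count (left_occ (m - d%:Z) z) (iota 0 M) = j &
     count (right_vac m z) (iota 0 M) = h]] in
  measurable E /\ mu E = (window_law d M k j h)%:E.
Proof.
move=> E.
have y0 : 0 < q / x by rewrite divr_gt0.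
have h3 := indep_event_count mu_coord false
  [seq m + 1 + l%:Z | l <- iota 0 M] _ _ _ h (indep_eventT mu_indep mu_coord).
have h2 := indep_event_count mu_coord true
  [seq m - l%:Z | l <- iota d M] _ _ _ j h3.
have h1 := indep_event_count mu_coord true
  [seq m - l%:Z | l <- iota 0 d] _ _ _ k h2.
move: h1; set E' := (X in indep_event _ X _).
have -> : E' = E.
  apply/seteqP; split => z.
    move=> [/= e1 [e2 [e3 _]]]; split.
    - by rewrite -e1 count_map; apply: eq_count => l /=; rewrite eqb_id.
    - rewrite -e2 count_map -[in RHS](addn0 d) iotaDl count_map.
      apply: eq_count => l /=; rewrite eqb_id /left_occ; congr (z _); lia.
    - by rewrite -e3 count_map; apply: eq_count => l /=; rewrite eqbF_neg.
  move=> [e1 e2 e3]; split=> /=.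
    by rewrite -e1 count_map; apply: eq_count => l /=; rewrite eqb_id.
  split=> /=.
    rewrite -e2 count_map -[in LHS](addn0 d) iotaDl count_map.
    apply: eq_count => l /=; rewrite eqb_id /left_occ; congr (z _); lia.
  split=> //=.
  by rewrite -e3 count_map; apply: eq_count => l /=; rewrite eqbF_neg.
move=> hE; split; first by case: hE.
rewrite (indep_event_prob _ _ _ _ hE); last by rewrite cats0 window_uniq.
congr (_%:E); rewrite -!map_comp.
rewrite !(eq_map (p_left : (_ =1 _))).
rewrite (eq_map (p_right : (_ =1 _))).
rewrite !bernoulli_sum_law_geometric // !expr0 !mulr1.
have prodE (t : R) n : \prod_(i < n) (1 + t * q ^+ i) = \prod_(i <- iota 0 n) (1 + t * q ^+ i).
  by rewrite -(big_mkord xpredT (fun i => 1 + t * q ^+ i)) /index_iota subn0.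
rewrite /window_law !prodE iotaD add0n big_cat /= !prodfV !invfM.
ring.
Qed.

(** The limit of [window_law] as the windows grow. Since block and left window share one product,
    the constant is the same for every block length [d], so laws for different [d] can be
    divided. *)
Lemma triple_event_law : exists2 C : R, 0 < C & forall d k j h,
  measurable (triple_event d k j h) /\
  mu (triple_event d k j h) =
    (C * ((x ^+ k * q ^+ 'C(k, 2) * gbin q d k) *
          ((x * q ^+ d) ^+ j * q ^+ 'C(j, 2) / qpoch q q j) *
          ((q / x) ^+ h * q ^+ 'C(h, 2) / qpoch q q h)))%:E.
Proof.
have y0 : 0 < q / x by rewrite divr_gt0.
have [l l0 hl] := cvg_prod_geometric q q_gt0 q_lt1 x (ltW x_gt0).
have [r r0 hr] := cvg_prod_geometric q q_gt0 q_lt1 (q / x) (ltW y0).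
exists (l * r)^-1; first by rewrite invr_gt0 mulr_gt0.
move=> d k j h.
pose E M := [set z : configType | [/\ count (left_occ m z) (iota 0 d) = k,
     count (left_occ (m - d%:Z) z) (iota 0 M) = j &
     count (right_vac m z) (iota 0 M) = h]].
have [] := cvg_probability mu E (triple_event d k j h).
- by move=> M; case: (window_event d M k j h).
- move=> z [e1 [N1 h1] [N2 h2]]; exists (maxn N1 N2) => // M /=.
  by rewrite geq_max => /andP[? ?]; split; [|exact: h1|exact: h2].
- move=> z nE.
  have [e1|ne1] := pselect (count (left_occ m z) (iota 0 d) = k); last first.
    by apply: nearW => M [].
  have [e2|/eventual_countPn[N hN]] := pselect (eventual_count (left_occ (m - d%:Z) z) j);
    last by exists N => // M /hN h1 [].
  have [e3|/eventual_countPn[N hN]] := pselect (eventual_count (right_vac m z) h);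
    last by exists N => // M /hN h1 [].
  by case: nE.
move=> mE cE; split=> //.
suff cW : window_law d M k j h @[M --> \oo] -->
   (l * r)^-1 * ((x ^+ k * q ^+ 'C(k, 2) * gbin q d k) *
          ((x * q ^+ d) ^+ j * q ^+ 'C(j, 2) / qpoch q q j) *
          ((q / x) ^+ h * q ^+ 'C(h, 2) / qpoch q q h)).
  apply: cvg_unique cE _ => //.
  have muE M : mu (E M) = (window_law d M k j h)%:E by case: (window_event d M k j h).
  have -> : (fun M => mu (E M)) = (fun M => (window_law d M k j h)%:E) by exact/funext.
  by apply: cvg_EFin; [exact: nearW|exact: cW].
rewrite [X in _ --> X]mulrC.
rewrite /window_law; apply: cvgM; last first.
  apply: cvgV; first by rewrite gt_eqF ?mulr_gt0.
  (* The product over [d + M] sites is a shift of the product over [M] sites and has the same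
     limit. *)
  apply: cvgM => //; under eq_fun do rewrite addnC.
  by have := hl; rewrite -(cvg_shiftn d).
apply: cvgM; last by apply: cvgMl_tmp; exact: cvg_gbin.
by apply: cvgMl_tmp; apply: cvgMl_tmp; exact: cvg_gbin.
Qed.

End joint_law.

(** * Holes minus particles relative to a movable cut *)

Lemma eventual_count_shiftn (b : nat -> bool) d j :
  eventual_count b (count b (iota 0 d) + j)%N <->
  eventual_count (fun i => b (d + i)%N) j.
Proof.
have E M : count b (iota 0 (d + M)) =
    (count b (iota 0 d) + count (fun i => b (d + i)%N) (iota 0 M))%N.
  by rewrite iotaD count_cat add0n -[in X in (_ + X)%N](addn0 d) iotaDl count_map.
split=> -[N hN]; last first.
  exists (d + N)%N => M NM; have -> : (M = d + (M - d))%N by lia.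
  by rewrite E hN //; lia.
exists N => M NM; have /eqP := hN (d + M)%N (leq_trans NM (leq_addl _ _)).
by rewrite E eqn_add2l => /eqP.
Qed.

(** The condition on N with the cut placed between [m] and [m + 1]; finiteness of both counts is
    built in, so the arithmetic stays in the integers. *)
Definition balance (m a : int) (z : config) : Prop :=
  exists l h : nat, [/\ eventual_count (left_occ m z) l,
    eventual_count (right_vac m z) h & h%:Z - l%:Z = a].

Lemma left_occS m z : (fun i => left_occ (m + 1) z (1 + i)%N) = left_occ m z.
Proof. by apply/funext => i; rewrite /left_occ; congr (z _); lia. Qed.

Lemma right_vacS m z : (fun i => right_vac m z (1 + i)%N) = right_vac (m + 1) z.
Proof. by apply/funext => i; rewrite /right_vac; congr (~~ z _); lia. Qed.

(** When the cut passes site [m + 1], either a particle joins the left count or a hole leaves the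
    right count; in both cases the difference drops by 1. *)
Lemma balanceS m a z : balance m a z <-> balance (m + 1) (a - 1) z.
Proof.
have l1 : count (left_occ (m + 1) z) (iota 0 1) = z (m + 1) :> nat.
  by rewrite /= addn0 /left_occ subr0.
have r1 : count (right_vac m z) (iota 0 1) = ~~ z (m + 1) :> nat.
  by rewrite /= addn0 /right_vac addr0.
split=> -[l [h [hl hh e]]].
  have := hl; rewrite -left_occS => /eventual_count_shiftn; rewrite l1 => hl'.
  (* Guarantees that the natural subtraction in the new hole count is not truncated. *)
  have rh : (~~ z (m + 1)%R <= h)%N.
    have := eventual_count_ge _ _ hh; by rewrite /right_vac addr0.
  have := hh; rewrite -(subnKC rh) -r1 => /eventual_count_shiftn.
  rewrite right_vacS => hh'.
  exists (z (m + 1)%R + l)%N, (h - ~~ z (m + 1)%R)%N; split => //; first by rewrite -r1.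
  by move: rh; case: (z _) => /=; lia.
have lh : (z (m + 1)%R <= l)%N.
  have := eventual_count_ge _ _ hl; by rewrite /left_occ subr0.
have := hl; rewrite -(subnKC lh) -l1 => /eventual_count_shiftn.
rewrite left_occS => hl'.
have := hh; rewrite -right_vacS => /eventual_count_shiftn; rewrite r1 => hh'.
exists (l - z (m + 1)%R)%N, (~~ z (m + 1)%R + h)%N; split => //; first by rewrite -l1.
by move: lh; case: (z _) => /=; lia.
Qed.

Lemma balance_shift m a z : balance 0 a z <-> balance m (a - m) z.
Proof.
elim/int_rec: m => [|n IH|n IH]; first by rewrite subr0.
- rewrite IH balanceS; have -> : n%:Z + 1 = n.+1 by lia.
  by have -> : a - n%:Z - 1 = a - n.+1%:Z by lia.
- rewrite IH (balanceS (- n.+1%:Z)).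
  have -> : - n.+1%:Z + 1 = - n%:Z by lia.
  by have -> : a - - n.+1%:Z - 1 = a - - n%:Z by lia.
Qed.

(** * Extended-real series as counts *)

Section series_of_counts.
Context {R : realType}.

Lemma NleftE m z : Nleft R m z = (\sum_(0 <= i <oo) ((left_occ m z i)%:R : R)%:E)%E.
Proof. by []. Qed.

Lemma NcountE z : Ncount R z =
  (\sum_(0 <= i <oo) ((right_vac 0 z i)%:R : R)%:E - Nleft R 0 z)%E.
Proof.
rewrite /Ncount /Nleft; congr (_ - _)%E; last first.
  by apply: eq_eseriesr => i _; rewrite sub0r.
rewrite -(nneseries_addn (f := fun i : nat => ((1 - (z i%:Z)%:R : R)%R%:E)) 1); last first.
  by move=> i; rewrite lee_fin; case: (z _); rewrite ?subrr ?subr0.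
apply: eq_eseriesr => i _; rewrite /right_vac add0r.
have -> : (i + 1)%N%:Z = 1 + i%:Z by lia.
by case: (z _); rewrite ?subrr ?subr0.
Qed.

Lemma Ncount_balance z n : Ncount R z = (n%:~R)%:E <-> balance 0 n z.
Proof.
rewrite NcountE NleftE; split.
  (* If either series is infinite, so is the difference, which contradicts the integer value; only
     the finite case survives. *)
  case: (series_countP (R := R) (right_vac 0 z)) => [[h hh ->]|->];
  case: (series_countP (R := R) (left_occ 0 z)) => [[l hl ->]|->] //.
  rewrite -EFinB => -[e]; exists l, h; split=> //.
  by apply: (@intr_inj R); rewrite -e rmorphB /= !pmulrn.
move=> [l [h [hl hh <-]]].
by rewrite (eventual_count_series _ _ hh) (eventual_count_series _ _ hl) -EFinB rmorphB.
Qed.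

(** The balance makes both left counts finite, so that their difference is a genuine subtraction. *)
Lemma Nleft_diff d m a z k : balance m a z ->
  (Nleft R m z - Nleft R (m - d%:Z) z)%E = (k%:R)%:E <->
  count (left_occ m z) (iota 0 d) = k.
Proof.
move=> [l [h [hl _ _]]]; rewrite !NleftE.
have sd : (fun i => left_occ m z (d + i)%N) = left_occ (m - d%:Z) z.
  by apply/funext => i; rewrite /left_occ; congr (z _); lia.
have dl : (count (left_occ m z) (iota 0 d) <= l)%N.
  case: (hl) => N hN; rewrite -(hN (maxn N d)) ?leq_maxl //.
  by apply: count_iota_le; exact: leq_maxr.
have := hl; rewrite -(subnKC dl) => /eventual_count_shiftn; rewrite sd => hl'.
rewrite (eventual_count_series _ _ hl) (eventual_count_series _ _ hl') -EFinB natrB //.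
rewrite opprB addrC subrK.
by split=> [[] /eqP|->] //; rewrite eqr_nat => /eqP.
Qed.
End series_of_counts.

(** * Integer parameters and exponents *)

Section durfee_int.
Context {R : realType} (q : R) (q_gt0 : 0 < q) (q_lt1 : q < 1).
Local Notation P := (qpoch q q).

(** For negative [a], shifting the index by |a| exchanges the roles of j and j + a and leads back to
    the natural-number identity for |a|. *)
Lemma durfee_int (a : int) :
  (\sum_(posz_part (- a) <= j <oo)
     (q ^ (j%:Z * (j%:Z + a)) / (P j * P (absz (j%:Z + a))))%:E)%E
  = ((qpoch_inf q q)^-1)%:E.
Proof.
have lim n : (\sum_(0 <= j <oo) (q ^+ (j * (j + n)) / (P j * P (j + n)))%:E)%E
    = ((qpoch_inf q q)^-1)%:E.
  apply/cvg_lim => //.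
  under eq_fun do rewrite sumEFin.
  by apply: cvg_EFin; [exact: nearW|exact: durfee].
case: (lerP 0 a) => a0.
  have -> : posz_part (- a) = 0%N by rewrite /posz_part; lia.
  rewrite -(lim `|a|%N); apply: eq_eseriesr => j _.
  have -> : j%:Z + a = (j + `|a|)%N by lia.
  by rewrite -PoszM -exprnP.
have -> : posz_part (- a) = `|a|%N by rewrite /posz_part; lia.
rewrite -nneseries_addn; last first.
  by move=> i; rewrite lee_fin divr_ge0 ?exprz_ge0 ?mulr_ge0 // ltW // qpoch_gt0.
rewrite -(lim `|a|%N); apply: eq_eseriesr => j _.
have -> : (j + `|a|)%N%:Z + a = j by lia.
by rewrite -PoszM -exprnP mulnC [P j * _]mulrC.
Qed.
End durfee_int.

Lemma int_bin2 (n : nat) : 2 * 'C(n, 2)%:Z = n%:Z * (n%:Z - 1).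
Proof.
elim: n => [|n IH] //; rewrite binS bin1 PoszD mulrDr IH; lia.
Qed.

Lemma triangular_int (a : int) : exists t : int, 2 * t = a * (a + 1).
Proof.
(* Both a = n and a = -(n+1) give a (a + 1) = n (n + 1). *)
by case: a => n; exists 'C(n.+1, 2)%:Z; rewrite int_bin2; lia.
Qed.

(** Under h = j + a + k the exponent of [x] collapses to -a. Completing squares in the exponent of
    [q] isolates x^(-a) q^t, which depends only on [a] and can join the constant. *)
Lemma triple_weight {R : realType} (q x : R) (a t : int) (d k j h : nat) :
  q != 0 -> x != 0 -> 2 * t = a * (a + 1) -> h%:Z = j%:Z + (a + k%:Z) ->
  x ^+ k * q ^+ 'C(k, 2) * ((x * q ^+ d) ^+ j * q ^+ 'C(j, 2)) *
    ((q / x) ^+ h * q ^+ 'C(h, 2)) =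
  x ^ (- a) * q ^ t * q ^ (k%:Z * (a + k%:Z)) *
    q ^ (j%:Z * (j%:Z + (a + k%:Z)) + d%:Z * j%:Z).
Proof.
move=> q0 x0 ht hh.
rewrite !exprMn exprVn -exprM exprnN !exprnP.
have -> : x ^ (- a) = x ^ k * x ^ j * x ^ (- h%:Z).
  by rewrite -!expfzDr //; congr (_ ^ _); lia.
suff E : q ^ t * q ^ (k%:Z * (a + k%:Z)) *
    q ^ (j%:Z * (j%:Z + (a + k%:Z)) + d%:Z * j%:Z) =
  q ^ 'C(k, 2) * q ^ (d * j)%N * q ^ 'C(j, 2) * q ^ h * q ^ 'C(h, 2).
  by rewrite -!mulrA !mulrA -[RHS]mulrA -[in RHS]mulrA [q ^ t * _]mulrA E; ring.
rewrite -!expfzDr //; congr (_ ^ _).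
have := int_bin2 k; have := int_bin2 j; have := int_bin2 h.
rewrite hh PoszM => h1 h2 h3.
(* Doubling turns the triangular numbers into polynomials. *)
apply: (@mulfI _ (2 : int)) => //.
rewrite !mulrDr ht h1 h2 h3; ring.
Qed.

(** * Law of the block count at a fixed balance *)

Section law.
Context {R : realType} {mu : probability configType R} {p : int -> bool -> R}.
Hypothesis mu_indep : mutually_independent mu (Defs.coord : int -> configType -> bool).
Hypothesis mu_coord : forall i b, mu [set z | z i = b] = (p i b)%:E.
Context {q x : R} (q_gt0 : 0 < q) (q_lt1 : q < 1) (x_gt0 : 0 < x) (m a : int).
Hypothesis p_left : forall l : nat,
  p (m - l%:Z) true = x * q ^+ l / (1 + x * q ^+ l).
Hypothesis p_right : forall l : nat,
  p (m + 1 + l%:Z) false = q / x * q ^+ l / (1 + q / x * q ^+ l).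
Local Notation P := (qpoch q q).

(** The event is partitioned by the number j of particles left of the block, which forces j + a + k
    holes on the right. *)
Lemma balance_law : exists2 C : R, 0 < C & forall d k,
  mu [set z | count (left_occ m z) (iota 0 d) = k /\ balance m a z] =
  ((C * (q ^ (k%:Z * (a + k%:Z)) * gbin q d k))%:E *
   \sum_(posz_part (- (a + k%:Z)) <= j <oo)
     (q ^ (j%:Z * (j%:Z + (a + k%:Z)) + d%:Z * j%:Z) /
        (P j * P (absz (j%:Z + (a + k%:Z)))))%:E)%E.
Proof.
have [C C0 hC] := triple_event_law mu_indep mu_coord q_gt0 q_lt1 x_gt0 m p_left p_right.
have [t ht] := triangular_int a.
exists (C * (x ^ (- a) * q ^ t)); first by rewrite !mulr_gt0 // exprz_gt0.
move=> d k; set b := a + k%:Z.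
(* The guard matters because [absz] would turn a negative hole count into a spurious positive
   one. *)
pose E j := if 0 <= j%:Z + b then triple_event m d k j (absz (j%:Z + b)) else set0.
have mE j : measurable (E j).
  by rewrite /E; case: ifP => _; [case: (hC d k j (absz (j%:Z + b)))|exact: measurable0].
have -> : [set z | count (left_occ m z) (iota 0 d) = k /\ balance m a z] = \bigcup_j E j.
  apply/seteqP; split=> z.
    move=> [zk [l [h [hl hh e]]]].
    have kl : (k <= l)%N.
      rewrite -zk; case: (hl) => N hN; rewrite -(hN (maxn N d)) ?leq_maxl //.
      by apply: count_iota_le; exact: leq_maxr.
    exists (l - k)%N => //; rewrite /E /b ifT; last by lia.
    have -> : absz ((l - k)%N%:Z + (a + k%:Z)) = h by lia.
    split=> //; have := (eventual_count_shiftn (left_occ m z) d (l - k)).1.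
    rewrite zk subnKC // => /(_ hl).
    congr (eventual_count _ _).
    by apply/funext => i; rewrite /left_occ; congr (z _); lia.
  move=> [j _]; rewrite /E; case: ifP => // jb [zk zj zh]; split=> //.
  exists (k + j)%N, (absz (j%:Z + b)); split=> //; last by rewrite /b in jb *; lia.
  rewrite -zk; apply/eventual_count_shiftn.
  move: zj; congr (eventual_count _ _).
  by apply/funext => i; rewrite /left_occ; congr (z _); lia.
have tE : trivIset setT E.
  apply/trivIsetP => i j _ _ ij; apply/seteqP; split => // z [].
  rewrite /E; case: ifP => // _ [_ zi _]; case: ifP => // _ [_ zj _].
  by move: ij; rewrite (eventual_count_inj _ _ _ zi zj) eqxx.
rewrite measure_semi_bigcup //; last exact: bigcup_measurable.
(* Indices below [posz_part (- b)] would need a negative number of holes, so their events are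
   empty. *)
rewrite (nneseries_split 0 (posz_part (- b))) // add0n big_nat big1 ?add0e; last first.
  move=> j; rewrite /posz_part /E => jb; rewrite ifF ?measure0 //.
  by apply/negbTE; lia.
rewrite -nneseriesZl; last first.
  by move=> i _; rewrite lee_fin divr_ge0 ?exprz_ge0 ?mulr_ge0 // ltW // qpoch_gt0.
(* Both series are restarted at 0, so that each shifted index is known to be at least
   [posz_part (- b)]. *)
rewrite -nneseries_addn // -[RHS]nneseries_addn; last first.
  move=> i; rewrite mule_ge0 // lee_fin.
    by rewrite !mulr_ge0 ?exprz_ge0 ?gbin_ge0 // ltW.
  by rewrite divr_ge0 ?exprz_ge0 ?mulr_ge0 // ltW // qpoch_gt0.
apply: eq_eseriesr => i _; move: (i + _)%N (leq_addl i (posz_part (- b))) => j jb.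
have jb0 : 0 <= j%:Z + b by move: jb; rewrite /posz_part; lia.
rewrite /E jb0 -EFinM; apply: etrans (hC d k j _).2 _; congr (_%:E).
have hj : (absz (j%:Z + b))%:Z = j%:Z + (a + k%:Z) by rewrite gez0_abs.
have := triple_weight q x a t d k j (absz (j%:Z + b)) (lt0r_neq0 q_gt0) (lt0r_neq0 x_gt0) ht hj.
rewrite -/b.
set U := x ^+ k * _; set V := (x * q ^+ d) ^+ j * _; set W := (q / x) ^+ _ * _ => e.
transitivity (C * (U * V * W) * gbin q d k / (P j * P (absz (j%:Z + b)))).
  by rewrite invfM; ring.
by rewrite e; ring.
Qed.
End law.

Theorem lemma1p4 (R : realType) (q : R) (q_gt0 : 0 < q) (q_lt1 : q < 1)
    (c : R) (mu : probability configType R)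
    (mu_blocking : is_blocking_measure q c mu)
    (n m1 m2 : int) (m12 : m1 + 1 < m2)
    (k : nat) (hk : (k <= absz (m2 - m1 - 1)%R)%N) :
  let m2hat := absz (m2 - m1 - 1)%R in
  ergodic_blocking mu n
    [set z | (Nleft R (m2 - 1) z - Nleft R m1 z)%E = (k%:R)%R%:E] =
  ((q ^ (k%:Z * (n + 1 + k%:Z - m2)) * qpoch_inf q q * qbinom q m2hat k)%R%:E *
   \sum_(posz_part (m2 - 1 - n - k%:Z)%R <= j <oo)
     (q ^ (j%:Z * (n + 1 - m2 + k%:Z + j%:Z) + m2hat%:Z * j%:Z) /
      (qpoch q q j * qpoch q q (absz (n + 1 - m2 + k%:Z + j%:Z)%R)))%R%:E)%E.
Proof.
move=> d; have [mu_indep mu_true] := mu_blocking.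
pose p i b := fine (mu [set z | z i = b]).
have mu_coord i b : mu [set z | z i = b] = (p i b)%:E.
  by rewrite fineK // fin_num_measure //; exact: measurable_coord.
have p_true i : p i true = q `^ (c - i%:~R) / (1 + q `^ (c - i%:~R)).
  by rewrite /p mu_true.
(* The cut is placed at the right end of the block; [a] is then the balance equivalent to N = n, and
   [x] the odds of a particle at [m]. *)
pose m := m2 - 1; pose a := n - m; pose x := q `^ (c - m%:~R).
have x0 : 0 < x by apply: powR_gt0.
have q0 := lt0r_neq0 q_gt0.
have powqD (r : R) (l : int) : q `^ (r + l%:~R) = q `^ r * q ^ l.
  by rewrite powRD ?q0 ?implybT // powR_intmul // ltW.
have p_left (l : nat) : p (m - l%:Z) true = x * q ^+ l / (1 + x * q ^+ l).
  rewrite p_true; suff -> : q `^ (c - (m - l%:Z)%:~R) = x * q ^+ l by [].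
  by rewrite exprnP -powqD rmorphB /=; congr (_ `^ _); ring.
have p_right (l : nat) :
    p (m + 1 + l%:Z) false = q / x * q ^+ l / (1 + q / x * q ^+ l).
  rewrite (marginalN mu_coord (m + 1 + l%:Z) true) p_true.
  (* If the particle odds are 1/y, the hole probability is 1 - y^(-1)/(1 + y^(-1)) = y/(1 + y). *)
  have -> : q `^ (c - (m + 1 + l%:Z)%:~R) = (q / x * q ^+ l)^-1.
    have -> : c - (m + 1 + l%:Z)%:~R = (c - m%:~R) + (- (1 + l%:Z))%:~R :> R.
      by rewrite !(rmorphD, rmorphN) /=; ring.
    by rewrite powqD -/x -invr_expz expfzDr // expr1z exprnP !invfM invrK; ring.
  have y0 : 0 < q / x * q ^+ l by rewrite !mulr_gt0 ?invr_gt0 // exprn_gt0.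
  move: (q / x * _) y0 => y y0.
  by field; rewrite !lt0r_neq0 ?addr_gt0 // ?invr_gt0 //.
have [C C0 law] := balance_law mu_indep mu_coord q_gt0 q_lt1 x0 m a p_left p_right.
have bal z : Ncount R z = n%:~R%:E <-> balance m a z.
  exact: (iff_trans (Ncount_balance z n) (balance_shift m n z)).
rewrite /ergodic_blocking /cond_prob.
(* Conditioning on N = n is the case of an empty block, so the same law with the same [C] serves
   numerator and denominator. *)
have -> : [set z : configType | Ncount R z = n%:~R%:E] =
    [set z | count (left_occ m z) (iota 0 0) = 0%N /\ balance m a z].
  by apply/seteqP; split=> z /= => [/bal|[_ /bal]].
rewrite [X in (_ / X)%E]law.
have -> : [set z : configType | (Nleft R (m2 - 1) z - Nleft R m1 z)%E = k%:R%:E] `&`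
      [set z | count (left_occ m z) (iota 0 0) = 0%N /\ balance m a z] =
    [set z | count (left_occ m z) (iota 0 d) = k /\ balance m a z].
  have -> : m1 = m - d%:Z by rewrite /m /d; lia.
  apply/seteqP; split=> z /= => [[h [_ hz]]|[h hz]].
    by split=> //; exact: ((Nleft_diff (R:=R) d m a z k hz).1 h).
  by split=> //; exact: ((Nleft_diff (R:=R) d m a z k hz).2 h).
rewrite law mul0r expr0z gbin0 !mulr1 addr0.
(* With [d] and [k] equal to 0 the denominator's series is the Durfee sum, with value 1/(q;q)_oo. *)
under [X in (_ / (_ * X))%E]eq_eseriesr => j _ do rewrite mul0r addr0.
rewrite durfee_int //.
have -> : (\sum_(posz_part (- (a + k%:Z)) <= j <oo)
     (q ^ (j%:Z * (j%:Z + (a + k%:Z)) + d%:Z * j%:Z) /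
        (qpoch q q j * qpoch q q (absz (j%:Z + (a + k%:Z)))))%:E)%E =
  (\sum_(posz_part (m2 - 1 - n - k%:Z)%R <= j <oo)
     (q ^ (j%:Z * (n + 1 - m2 + k%:Z + j%:Z) + d%:Z * j%:Z) /
      (qpoch q q j * qpoch q q (absz (n + 1 - m2 + k%:Z + j%:Z)%R)))%R%:E)%E.
  have -> : - (a + k%:Z) = m2 - 1 - n - k%:Z by rewrite /a /m; lia.
  apply: eq_eseriesr => j _.
  by have -> : j%:Z + (a + k%:Z) = n + 1 - m2 + k%:Z + j%:Z by rewrite /a /m; lia.
have -> : a + k%:Z = n + 1 + k%:Z - m2 by rewrite /a /m; lia.
rewrite gbin_qbinom // -EFinM inver.
have P0 : qpoch_inf q q != 0 by apply: qpoch_inf_neq0.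
(* The extended-real inverse treats 0 separately; here the denominator is C/(q;q)_oo, which is
   nonzero. *)
rewrite ifF; last by apply/negbTE; rewrite mulf_neq0 ?invr_eq0 // lt0r_neq0.
rewrite -muleA [(_ * (_%:E))%E in LHS]muleC muleA -EFinM.
congr (_%:E * _)%E; field.
by rewrite P0 lt0r_neq0.
Qed.
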